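(* Let $0<\alpha<n$ and let $Q_0\subset\mathbb{R}^n$ be a finite open cube. Let $f\in\mathrm{BMO}(Q_0)$ with $\operatorname{supp}(f)\subset Q_0$. Then $\mathcal{M}_\alpha f$ is uniformly continuous on $\mathbb{R}^n$. Consequently, $\mathcal{M}_\alpha f\in\mathrm{VMO}(Q_0)$.
   Context: All cubes are open with sides parallel to the coordinate axes; $\ell(Q)$ is the side length of $Q$. A function with $\operatorname{supp}(f)\subset Q_0$ is regarded as a function on $\mathbb{R}^n$ vanishing outside $Q_0$. $\mathcal{M}_\alpha f(x)=\sup_{Q\ni x}\ell(Q)^{-(n-\alpha)}\int_Q|f(y)|\,dy$, supremum over all open cubes $Q\subset\mathbb{R}^n$ containing $x$. For a cube $Q$ put $\mathcal{O}(f,Q)=\inf_{c\in\mathbb{R}}\ell(Q)^{-n}\int_Q|f-c|\,dx$. $\mathrm{BMO}(Q_0)$ is the space of locally integrable $f$ with $\|f\|_{\mathrm{BMO}(Q_0)}=\sup_Q\mathcal{O}(f,Q)<\infty$, supremum over all finite subcubes $Q$ of $Q_0$ parallel to $Q_0$. A function $f\in\mathrm{BMO}(Q_0)$ belongs to $\mathrm{VMO}(Q_0)$ if $\lim_{r\to0^+}\sup_{Q\subset Q_0,\ \ell(Q)\le r}\mathcal{O}(f,Q)=0$. *)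

(* Defs.v *)
From HB Require Import structures.
From mathcomp Require Import all_boot all_order all_algebra.
From mathcomp Require Import all_classical all_reals all_analysis.

Set Implicit Arguments.
Unset Strict Implicit.
Unset Printing Implicit Defensive.

Import Order.TTheory GRing.Theory Num.Theory.
Import numFieldNormedType.Exports.

Local Open Scope classical_set_scope.
Local Open Scope ring_scope.

Definition measure_rV_display (R : realType) : measure_display.
Proof. exact: default_measure_display. Qed.

(* The product sigma-algebra on R^n, following the instance for n.-tuple. *)
Section measurable_rV.
Context {R : realType} {n : nat}.

Definition rV_coord (i : 'I_n) (x : 'rV[R]_n) : measurableTypeR R := x ord0 i.

Let rV_set0 : g_sigma_preimage rV_coord set0.
Proof. exact: sigma_algebra0. Qed.

Let rV_setC A : g_sigma_preimage rV_coord A -> g_sigma_preimage rV_coord (~` A).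
Proof. exact: sigma_algebraC. Qed.

Let rV_bigcup (F : (set _)^nat) : (forall i, g_sigma_preimage rV_coord (F i)) ->
  g_sigma_preimage rV_coord (\bigcup_i (F i)).
Proof. exact: sigma_algebra_bigcup. Qed.

HB.instance Definition _ := @isMeasurable.Build (measure_rV_display R)
  'rV[R]_n (g_sigma_preimage rV_coord) rV_set0 rV_setC rV_bigcup.

Lemma measurable_rV_coord (i : 'I_n) : measurable_fun [set: 'rV[R]_n] (rV_coord i).
Proof.
move=> _ Y mY; rewrite setTI; apply: sub_sigma_algebra => /=.
rewrite -bigcup_seq/=; exists i => /=; first by rewrite mem_index_enum.
by exists Y => //; rewrite setTI.
Qed.

Lemma measurable_fun_rVP d (T : measurableType d) (f : T -> 'rV[R]_n) :
  (forall i, measurable_fun [set: T] (rV_coord i \o f)) ->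
  measurable_fun [set: T] f.
Proof.
move=> mf.
suff : g_sigma_preimage (fun i => rV_coord i \o f) `<=` measurable.
  rewrite g_sigma_preimage_comp => prefS _ A mA.
  by apply: prefS; exists A.
apply: smallest_sub; first exact: sigma_algebra_measurable.
rewrite -bigcup_seq; apply: bigcup_sub => i _.
by move=> A [B mB <-]; exact: mf.
Qed.

End measurable_rV.

(* Lebesgue measure on the Borel sets of R^n, by iterated products:
   R^(n+1) is the image of R x R^n under [rV_cons]. *)
Section lebesgue_rV_succ.
Local Open Scope ereal_scope.
Context {R : realType} {n : nat}.

Definition rV_cons (p : measurableTypeR R * 'rV[R]_n) : 'rV[R]_n.+1 :=
  \row_i oapp (p.2 ord0) (p.1 : R) (unlift ord0 i).

Lemma measurable_rV_cons : measurable_fun setT rV_cons.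
Proof.
apply: measurable_fun_rVP => i.
case: (unliftP ord0 i) => [j|] ij.
  rewrite (_ : _ \o _ = rV_coord j \o snd).
    exact: (measurableT_comp (measurable_rV_coord j) measurable_snd).
  by apply/funext => p; rewrite /= /rV_coord mxE ij liftK.
rewrite (_ : _ \o _ = fst); first exact: measurable_fst.
by apply/funext => p; rewrite /= /rV_coord mxE ij unlift_none.
Qed.

Variable nu : {sigma_finite_measure set 'rV[R]_n -> \bar R}.

Definition lebesgue_rV_succ : set 'rV[R]_n.+1 -> \bar R :=
  pushforward ((@lebesgue_measure R) \x nu) rV_cons.

Let succ0 : lebesgue_rV_succ set0 = 0.
Proof. by rewrite /lebesgue_rV_succ /pushforward preimage_set0 measure0. Qed.

Let succ_ge0 A : 0 <= lebesgue_rV_succ A.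
Proof. exact: (measure_ge0 (lebesgue_measure \x nu)). Qed.

Let succ_sigma_additive : semi_sigma_additive lebesgue_rV_succ.
Proof.
move=> F mF tF mUF; rewrite /lebesgue_rV_succ /pushforward preimage_bigcup.
apply: measure_semi_sigma_additive.
- by move=> k; rewrite -[X in measurable X]setTI; exact: measurable_rV_cons.
- apply/trivIsetP => /= i j _ _ ij; rewrite -preimage_setI.
  by move/trivIsetP : tF => /(_ _ _ _ _ ij) ->//; rewrite preimage_set0.
- rewrite -preimage_bigcup -[X in measurable X]setTI.
  exact: measurable_rV_cons.
Qed.

HB.instance Definition _ := isMeasure.Build _ _ _ lebesgue_rV_succ
  succ0 succ_ge0 succ_sigma_additive.

Lemma measurable_rV_head_tail :
  measurable_fun [set: 'rV[R]_n.+1]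
    (fun x => (x ord0 ord0, \row_i x ord0 (lift ord0 i))
       : measurableTypeR R * 'rV[R]_n).
Proof.
apply: measurable_fun_pair; first exact: measurable_rV_coord.
apply: measurable_fun_rVP => i.
rewrite (_ : _ \o _ = rV_coord (lift ord0 i)); first exact: measurable_rV_coord.
by apply/funext => x; rewrite /= /rV_coord mxE.
Qed.

Lemma rV_consK (p : measurableTypeR R * 'rV[R]_n) :
  ((rV_cons p) ord0 ord0, \row_i (rV_cons p) ord0 (lift ord0 i)) = p.
Proof.
case: p => a v; congr pair; first by rewrite mxE unlift_none.
by apply/rowP => i; rewrite !mxE liftK.
Qed.

Let succ_sigma_finite : sigma_finite setT lebesgue_rV_succ.
Proof.
have /sigma_finiteP[F [TF ndF Foo]] := sigma_finiteT (@lebesgue_measure R).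
have /sigma_finiteP[G [TG ndG Goo]] := sigma_finiteT nu.
pose ht := fun x : 'rV[R]_n.+1 => (x ord0 ord0, \row_i x ord0 (lift ord0 i))
       : measurableTypeR R * 'rV[R]_n.
exists (fun k => ht @^-1` (F k `*` G k)).
  apply/esym/seteqP; split => // x _.
  have [k _ Fk] : (\bigcup_i F i) (ht x).1 by rewrite -TF.
  have [l _ Gl] : (\bigcup_i G i) (ht x).2 by rewrite -TG.
  exists (maxn k l) => //; split.
    by move: Fk; exact/subsetPset/ndF/leq_maxl.
  by move: Gl; exact/subsetPset/ndG/leq_maxr.
move=> k; have [mF Fkoo] := Foo k; have [mG Gkoo] := Goo k; split.
  rewrite -[X in measurable X]setTI.
  by apply: measurable_rV_head_tail => //; exact: measurableX.
rewrite /lebesgue_rV_succ /pushforward.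
rewrite (_ : rV_cons @^-1` _ = F k `*` G k); last first.
  rewrite -comp_preimage (_ : ht \o rV_cons = id)//.
  by apply/funext => p; exact: rV_consK.
by rewrite product_measure1E// lte_mul_pinfty// ge0_fin_numE.
Qed.

HB.instance Definition _ := Measure_isSigmaFinite.Build _ _ _ lebesgue_rV_succ
  succ_sigma_finite.

End lebesgue_rV_succ.

Fixpoint lebesgue_rV (R : realType) (n : nat) :
    {sigma_finite_measure set 'rV[R]_n -> \bar R} :=
  match n with
  | 0%N => (\d_ (0 : 'rV[R]_0) : {sigma_finite_measure set _ -> \bar R})
  | n'.+1 => (lebesgue_rV_succ (lebesgue_rV R n') :
               {sigma_finite_measure set _ -> \bar R})
  end.

(* R^n with the sigma-algebra of Lebesgue (not just Borel) measurable sets,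
   and its complete Lebesgue measure. *)
Definition lebesgue_space (R : realType) (n : nat) :=
  caratheodory_type (mu_ext (lebesgue_rV R n)).

HB.instance Definition _ (R : realType) (n : nat) :=
  Measurable.on (lebesgue_space R n).

Definition lebesgue (R : realType) (n : nat) :
    set (lebesgue_space R n) -> \bar R :=
  @completed_measure_extension _ _ _ (lebesgue_rV R n).

HB.instance Definition _ (R : realType) (n : nat) :=
  Measure.on (@lebesgue R n).

(* Open cubes with sides parallel to the axes, given by their lower corner and
   (finite, positive) side length. *)
Record cube (R : realType) (n : nat) := Cube {
  corner : 'rV[R]_n;
  side : R;
  side_gt0 : 0 < side }.

Definition cube_set (R : realType) (n : nat) (Q : cube R n) : set 'rV[R]_n :=
  [set x | forall i, corner Q ord0 i < x ord0 i < corner Q ord0 i + side Q].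

Lemma measurable_cube_set (R : realType) (n : nat) (Q : cube R n) :
  measurable (cube_set Q).
Proof.
rewrite (_ : cube_set Q = \big[setI/setT]_(i < n) (@rV_coord R n i @^-1`
    `]corner Q ord0 i, corner Q ord0 i + side Q[)).
  apply: bigsetI_measurable => i _; rewrite -[X in measurable X]setTI.
  exact: measurable_rV_coord.
apply/seteqP; split => x /=.
  by move=> h; rewrite -bigcap_seq => i _ /=; rewrite in_itv/= h.
rewrite -bigcap_seq => h i.
by have := h i (mem_index_enum i); rewrite /= in_itv.
Qed.

Lemma lebesgue_rV_cube (R : realType) (n : nat) (Q : cube R n) :
  lebesgue_rV R n (cube_set Q) = (side Q ^+ n)%:E.
Proof.
elim: n Q => [|n ih] [a l l0].
  by rewrite /= diracE mem_set//; case.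
rewrite /= /lebesgue_rV_succ /pushforward.
rewrite (_ : _ @^-1` _ = `]a ord0 ord0, a ord0 ord0 + l[ `*`
    cube_set (Cube (\row_i a ord0 (lift ord0 i)) l0)).
  rewrite product_measure1E//; last exact: measurable_cube_set.
  rewrite ih [X in (X * _)%E](_ : _ = l%:E) ?exprS//.
  rewrite [LHS](lebesgue_measure_itv `]a ord0 ord0, a ord0 ord0 + l[) /=.
  by rewrite lte_fin ltrDl l0 -EFinD addrAC subrr add0r.
apply/seteqP; split => -[u v] /=.
  move=> h; split.
    by have := h ord0; rewrite mxE unlift_none/= in_itv.
  by move=> i; have := h (lift ord0 i); rewrite !mxE liftK.
move=> [h1 h2] i; rewrite mxE.
case: (unliftP ord0 i) => [j|] -> /=.
  by have := h2 j; rewrite mxE.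
by rewrite in_itv in h1.
Qed.

Lemma lebesgue_cube (R : realType) (n : nat) (Q : cube R n) :
  lebesgue (cube_set Q) = (side Q ^+ n)%:E.
Proof.
rewrite /lebesgue /completed_measure_extension measurable_mu_extE /=.
  exact: lebesgue_rV_cube.
exact: measurable_cube_set.
Qed.

Section spaces.
Local Open Scope ereal_scope.
Context {R : realType} {n : nat}.
Implicit Types (Q : cube R n) (f : 'rV[R]_n -> R).

Local Notation mu := (@lebesgue R n).

(* The library's [locally_integrable], which is only stated on R. *)
Definition locally_integrable_rV (D : set 'rV[R]_n) f :=
  [/\ measurable_fun (D : set (lebesgue_space R n))
        (f : lebesgue_space R n -> R),
      open D &
      forall K : set 'rV[R]_n, K `<=` D -> compact K ->
        \int[mu]_(x in K) `|f x|%R%:E < +oo].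

Definition frac_maximal (alpha : R) f (x : 'rV[R]_n) : \bar R :=
  ereal_sup [set (side Q `^ (- (n%:R - alpha)))%R%:E
                   * \int[mu]_(y in cube_set Q) `|f y|%R%:E
            | Q in [set Q : cube R n | cube_set Q x]].

Definition oscillation f Q : \bar R :=
  ereal_inf [set (side Q ^- n)%R%:E
                   * \int[mu]_(x in cube_set Q) `|f x - c|%R%:E
            | c in [set: R]].

Definition subcubes (Q0 : cube R n) : set (cube R n) :=
  [set Q | cube_set Q `<=` cube_set Q0].

Definition BMO_seminorm (Q0 : cube R n) f : \bar R :=
  ereal_sup [set oscillation f Q | Q in subcubes Q0].

Definition BMO (Q0 : cube R n) f : Prop :=
  locally_integrable_rV (cube_set Q0) f /\ BMO_seminorm Q0 f < +oo.

Definition VMO (Q0 : cube R n) f : Prop :=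
  BMO Q0 f /\
  ereal_sup [set oscillation f Q
            | Q in [set Q | subcubes Q0 Q /\ (side Q <= r)%R]]
    @[r --> 0^'+] --> 0.

End spaces.

(* Main.v *)
Require Import Defs.
From mathcomp Require Import all_boot all_order all_algebra.
From mathcomp Require Import all_classical all_reals all_analysis.
From mathcomp Require Import measurable_realfun ring lra.
Import Order.TTheory GRing.Theory Num.Theory.
Import numFieldNormedType.Exports.
Local Open Scope classical_set_scope.
Local Open Scope ring_scope.

(** Write w(Q) for the integral of |f| over the cube Q, l(Q) for its side, and
    V(Q) = l(Q)^(alpha - n) w(Q), so that the maximal function at x is the
    supremum of V over the cubes containing x.  Two facts give its uniform
    continuity.

    Small cubes are negligible.  Bounded mean oscillation makes the average of
    |f| grow by at most a constant when a cube is replaced by a half-size cube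
    inside it, so averages over cubes of side l grow only logarithmically in
    1/l.  The weaker Morrey bound w(Q) <= A l(Q)^(n - b) for a single b in
    ]0, alpha[ is all that is needed, and it follows by induction on the number
    of halvings ([mass_doubling], [doubling_morrey]).  A cube that sticks out of
    Q0 is first slid into Q0 ([cube_slide]), which loses nothing since f vanishes
    outside Q0.  Hence V(Q) <= A l(Q)^(alpha - b), which tends to 0 with l(Q),
    uniformly in Q.

    Large cubes can be moved.  If Q contains x and y is within h of x in the sup
    norm, the cube Q' with the same centre and side l(Q) + 2h contains y, and
    V(Q) <= (1 + 2h/l(Q))^(n - alpha) V(Q').  For l(Q) bounded below and h small
    the factor is close to 1, and V is bounded, so V(Q) <= V(Q') + e
    ([scaled_modulus]).  Taking suprema, the maximal function at x exceeds its
    value at y by at most e.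

    A bounded uniformly continuous function is in VMO: its oscillation on a small
    cube is at most its variation there ([unif_continuous_bounded_VMO]). *)

Set Implicit Arguments.
Unset Strict Implicit.
Unset Printing Implicit Defensive.

(** * Integrals of norms *)

Section NormIntegrals.
Context d (T : measurableType d) (R : realType).
Variable mu : {measure set T -> \bar R}.
Implicit Types (A B D S : set T) (f g : T -> R).
Local Open Scope ereal_scope.

Lemma measurable_norm_EFin D f :
  measurable_fun D f -> measurable_fun D (fun x => `|f x|%:E).
Proof. by move=> mf; apply/measurable_EFinP/measurableT_comp. Qed.

Lemma integral_norm_le_subset A B f : measurable A -> measurable B ->
  measurable_fun B f -> A `<=` B ->
  \int[mu]_(x in A) `|f x|%:E <= \int[mu]_(x in B) `|f x|%:E.
Proof.
by move=> mA mB mf; apply: ge0_subset_integral => //; exact: measurable_norm_EFin.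
Qed.

(** Both integrals see [f] only on [S], so measurability there and the inclusion
    of the traces on [S] suffice. *)
Lemma integral_norm_le_support S A B f : measurable S ->
  measurable_fun S f -> [set x | f x != 0%R] `<=` S ->
  measurable A -> measurable B -> A `&` S `<=` B ->
  \int[mu]_(x in A) `|f x|%:E <= \int[mu]_(x in B) `|f x|%:E.
Proof.
move=> mS mf f0 mA mB AB.
have capE D : \int[mu]_(x in D) `|f x|%:E = \int[mu]_(x in D `&` S) `|f x|%:E.
  rewrite integral_mkcond [RHS]integral_mkcond; congr (integral _ _ _).
  apply/funext => x; rewrite !patchE.
  have [xD|xD] := boolP (x \in D); last by rewrite ifF// in_setI (negbTE xD).
  case: ifPn => //; rewrite in_setI xD /= => xS.
  have [->|/f0 fx] := eqVneq (f x) 0%R; first by rewrite normr0.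
  by rewrite (mem_set fx) in xS.
rewrite capE [leRHS]capE; apply: integral_norm_le_subset.
- exact: measurableI.
- exact: measurableI.
- by apply: measurable_funS mf => // x [].
- by move=> x [Ax Sx]; split=> //; exact: AB.
Qed.

Lemma integral_norm_sub_le D f g : measurable D ->
  measurable_fun D f -> measurable_fun D g ->
  \int[mu]_(x in D) `|f x|%:E <=
  \int[mu]_(x in D) `|g x|%:E + \int[mu]_(x in D) `|f x - g x|%:E.
Proof.
move=> mD mf mg.
have mfg : measurable_fun D (fun x => `|f x - g x|%:E).
  by apply/measurable_EFinP/measurableT_comp => //; exact: measurable_funB.
rewrite -ge0_integralD//; last exact: measurable_norm_EFin.
apply: ge0_le_integral => //; first exact: measurable_norm_EFin.
- by apply: emeasurable_funD => //; exact: measurable_norm_EFin.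
- by move=> x _; rewrite -EFinD lee_fin -{1}(subrKC (g x) (f x)) ler_normD.
Qed.

Lemma integral_norm_cst D (c : R) : measurable D ->
  \int[mu]_(x in D) `|c|%:E = `|c|%:E * mu D.
Proof. by move=> mD; rewrite integral_cst. Qed.

Lemma integral_norm_le_bound D g (M : R) : measurable D ->
  measurable_fun D g -> (forall x, D x -> (`|g x| <= M)%R) ->
  \int[mu]_(x in D) `|g x|%:E <= M%:E * mu D.
Proof.
move=> mD mg gM; rewrite -integral_cst//; apply: ge0_le_integral => //.
exact: measurable_norm_EFin.
Qed.

End NormIntegrals.

(** * Sliding, doubling and thickening cubes *)

Section CubeGeometry.
Context {R : realType} {n : nat}.
Implicit Types Q : cube R n.

(** The corner is clamped coordinatewise into the range where the translate fits
    in [Q0].  In each coordinate the interval moves only if it overhangs [Q0],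
    and then just until its overhanging end meets that of [Q0], so it uncovers
    no point of [Q0]. *)
Lemma cube_slide Q0 Q : side Q <= side Q0 ->
  exists Q', [/\ side Q' = side Q, cube_set Q' `<=` cube_set Q0 &
    cube_set Q `&` cube_set Q0 `<=` cube_set Q'].
Proof.
case: Q0 Q => [a0 l0 l00] [a l l_gt0] /= ll0.
pose b : 'rV[R]_n := \row_i
  Num.min (Num.max (a ord0 i) (a0 ord0 i)) (a0 ord0 i + l0 - l).
exists (Cube b l_gt0); split=> //= x /=.
  move=> xb i; have := xb i; rewrite mxE /= minEle maxEle.
  by case: (leP (a _ _)) => h1; case: (leP _ (_ - l)) => h2; lra.
move=> [xa xa0] i; have := xa i; have := xa0 i; rewrite mxE /= minEle maxEle.
by case: (leP (a _ _)) => h1; case: (leP _ (_ - l)) => h2; lra.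
Qed.

(** Doubling from the lower corner may leave [Q0]; sliding repairs this. *)
Lemma cube_double Q0 Q : 2 * side Q <= side Q0 ->
  exists Q', [/\ side Q' = 2 * side Q, cube_set Q' `<=` cube_set Q0 &
    cube_set Q `&` cube_set Q0 `<=` cube_set Q'].
Proof.
move=> le; have s0 : 0 < 2 * side Q by rewrite mulr_gt0// side_gt0.
have [//|Q' [sQ' sub cov]] := @cube_slide Q0 (Cube (corner Q) s0).
exists Q'; split=> // x [xQ xQ0]; apply: cov; split=> // i /=.
by have := xQ i; have := side_gt0 Q; lra.
Qed.

Lemma cube_thicken Q (h : R) (x y : 'rV[R]_n) : 0 <= h ->
  cube_set Q x -> (forall i, `|x ord0 i - y ord0 i| <= h) ->
  exists Q', [/\ side Q' = side Q + 2 * h, cube_set Q' y &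
    cube_set Q `<=` cube_set Q'].
Proof.
move=> h0 xQ xy.
have s0 : 0 < side Q + 2 * h by have := side_gt0 Q; lra.
exists (Cube (\row_i (corner Q ord0 i - h)) s0); split => //= [i|z zQ i].
  by rewrite mxE; have := xQ i; have := xy i; rewrite ler_norml /=; lra.
by rewrite mxE /=; have := zQ i; lra.
Qed.

Lemma Lmeasurable_Borel (A : set 'rV[R]_n) :
  measurable A -> measurable (A : set (lebesgue_space R n)).
Proof.
move=> mA; apply: (@sub_caratheodory _ _ _ (lebesgue_rV R n) A).
exact: sub_sigma_algebra.
Qed.

Lemma Lmeasurable_cube Q : measurable (cube_set Q : set (lebesgue_space R n)).
Proof. by apply: Lmeasurable_Borel; exact: measurable_cube_set. Qed.

End CubeGeometry.

(** * Comparing a cube with its double under bounded mean oscillation *)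

Section Doubling.
Context {R : realType} {n : nat}.
Variables (Q0 : cube R n) (f : 'rV[R]_n -> R).
Hypothesis mf : measurable_fun (cube_set Q0 : set (lebesgue_space R n))
  (f : lebesgue_space R n -> R).
Hypothesis f0 : [set x | f x != 0] `<=` cube_set Q0.
Hypothesis bmo : (BMO_seminorm Q0 f < +oo)%E.
Local Notation mu := (@lebesgue R n).
Local Notation T := (lebesgue_space R n).
Local Notation mass Q := (\int[mu]_(y in (cube_set Q : set T)) `|f y|%R%:E)%E.
Implicit Types Q : cube R n.

(** The infimum over constants need not be attained, but any [K] above the
    seminorm is beaten by some constant on every subcube. *)
Lemma BMO_center : exists2 K : R, 0 <= K & forall Q,
  cube_set Q `<=` cube_set Q0 -> exists c : R,
  (\int[mu]_(x in (cube_set Q : set T)) `|f x - c|%:E <= (K * side Q ^+ n)%:E)%E.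
Proof.
have [K K0 bK] : exists2 K : R, 0 <= K & (BMO_seminorm Q0 f < K%:E)%E.
  case: (BMO_seminorm Q0 f) bmo => [r _| |] //.
    by exists (`|r| + 1); rewrite ?addr_ge0// lte_fin ltr_pwDr// ler_norm.
  by move=> _; exists 0 => //; rewrite ltNyr.
exists K => // Q sQ.
have /ereal_inf_lt[_ [c _ <-] cK] : (oscillation f Q < K%:E)%E.
  by apply: le_lt_trans bK; apply: ereal_sup_ubound; exists Q.
exists c; have sn : 0 < side Q ^+ n by rewrite exprn_gt0// side_gt0.
rewrite mulrC EFinM -lee_pdivrMl//.
exact: (ltW cK).
Qed.

Lemma BMO_integrable : (mass Q0 < +oo)%E.
Proof.
have [K K0 bK] := BMO_center.
have [c bc] := bK Q0 (@subset_refl _ _).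
have mQ0 := Lmeasurable_cube Q0.
have mc : measurable_fun (cube_set Q0 : set T) (fun _ => c) by exact: measurable_cst.
apply: le_lt_trans (integral_norm_sub_le mu mQ0 mf mc) _.
rewrite integral_norm_cst// [X in (_ * X + _)%E](lebesgue_cube Q0).
by apply: lte_add_pinfty; [rewrite -EFinM ltry|rewrite (le_lt_trans bc)// ltry].
Qed.

(** With [c] almost optimal on [Q'], the integral of |f| over [Q] is at most
    |c| side(Q)^n plus the oscillation integral over [Q'], while |c| itself is
    at most the average of |f| over [Q'] plus the mean oscillation there. *)
Lemma mass_doubling : exists2 C : R, 0 <= C & forall Q, 2 * side Q <= side Q0 ->
  exists2 Q', side Q' = 2 * side Q &
  (mass Q <= (2 ^- n)%:E * mass Q' + (C * side Q ^+ n)%:E)%E.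
Proof.
have [K K0 bK] := BMO_center.
exists (K * 2 ^+ n + K) => [|Q sQ].
  by rewrite addr_ge0// mulr_ge0// exprn_ge0.
have [Q' [sQ' Q'Q0 QQ']] := cube_double sQ.
exists Q' => //.
have [c bc] := bK _ Q'Q0.
(* The part of Q that f sees; unlike Q it lies inside Q', where f is
   measurable and its oscillation is controlled. *)
pose E : set T := cube_set Q `&` cube_set Q0.
have mQ := Lmeasurable_cube Q; have mQ' := Lmeasurable_cube Q'.
have mQ0 := Lmeasurable_cube Q0.
have mE : measurable E by exact: measurableI mQ mQ0.
have mfQ' : measurable_fun (cube_set Q' : set T) (f : T -> R).
  exact: measurable_funS mQ0 Q'Q0 mf.
have mfE : measurable_fun E (f : T -> R).
  exact: measurable_funS mQ' QQ' mfQ'.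
have mc (D : set T) : measurable_fun D (fun _ => c) by exact: measurable_cst.
have muE : (mu E <= (side Q ^+ n)%:E)%E.
  by rewrite -(lebesgue_cube Q); apply: le_measure (@subIsetl _ _ _); rewrite ?inE.
have upper : (mass Q <= (`|c| * side Q ^+ n)%:E + (K * side Q' ^+ n)%:E)%E.
  apply: (@le_trans _ _ (\int[mu]_(x in E) `|f x|%:E)%E).
    apply: (integral_norm_le_support mu mQ0 mf f0 mQ mE) => x Ex.
    exact: Ex.
  apply: le_trans (integral_norm_sub_le mu mE mfE (mc E)) _.
  rewrite integral_norm_cst// EFinM; apply: leeD.
    by rewrite lee_wpmul2l// lee_fin.
  apply: le_trans bc; apply: (integral_norm_le_subset mu mE mQ' _ QQ').
  exact: measurable_funB.
have lower : ((`|c| * side Q' ^+ n)%:E <= mass Q' + (K * side Q' ^+ n)%:E)%E.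
  rewrite EFinM -(lebesgue_cube Q') -(integral_norm_cst mu c mQ').
  apply: le_trans (integral_norm_sub_le mu mQ' (mc _) mfQ') _.
  rewrite leeD2l//; apply: le_trans bc.
  by under eq_integral do rewrite distrC.
have pw : side Q' ^+ n = 2 ^+ n * side Q ^+ n by rewrite sQ' exprMn.
apply: (le_trans upper).
have {}lower : ((`|c| * side Q ^+ n)%:E <=
    (2 ^- n)%:E * mass Q' + (K * side Q ^+ n)%:E)%E.
  have p2 : 0 < 2 ^+ n :> R by rewrite exprn_gt0.
  rewrite -(@lee_pmul2l _ (2 ^+ n)%:E)// ge0_muleDr ?mule_ge0 ?integral_ge0 ?lee_fin ?invr_ge0 ?(ltW p2) ?mulr_ge0 ?exprn_ge0 ?(ltW (side_gt0 Q))//.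
  rewrite muleA -!EFinM divff ?gt_eqF// mul1e mulrCA -pw.
  by apply: (le_trans lower); rewrite mulrCA -pw.
apply: (le_trans (leeD2r _ lower)).
rewrite -addeA leeD2l// -EFinD lee_fin pw.
lra.
Qed.
End Doubling.

(** * From doubling to a Morrey bound *)

Section RealPowers.
Context {R : realType}.
Implicit Types x y p r : R.

Lemma powR_rootK x p : 0 < p -> 0 <= x -> (x `^ p^-1) `^ p = x.
Proof. by move=> p0 x0; rewrite -powRrM mulVf ?gt_eqF// powRr1. Qed.

Lemma one_powR p : 1 `^ p = 1 :> R.
Proof. by rewrite powR1. Qed.

Lemma le_powR_base p x y : 0 <= p -> 0 <= x -> x <= y -> x `^ p <= y `^ p.
Proof.
by move=> p0 x0 xy; apply: ge0_ler_powR => //; rewrite nnegrE//; exact: le_trans xy.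
Qed.

Lemma lt_powR_base p x y : 0 < p -> 0 <= x -> x < y -> x `^ p < y `^ p.
Proof.
move=> p0 x0 xy; apply: gt0_ltr_powR => //; rewrite nnegrE//.
exact: le_trans (ltW xy).
Qed.

Lemma powR_exp_sub x (m : nat) r : 0 < x -> x `^ (m%:R - r) * x `^ r = x ^+ m.
Proof.
move=> x0; rewrite -powRD; last by rewrite (gt_eqF x0) implybT.
by rewrite subrK powR_mulrn// ltW.
Qed.

End RealPowers.

Section Morrey.
Context {R : realType} {n : nat}.
Variables (w : cube R n -> R) (l0 W C b : R).
Hypotheses (l0_gt0 : 0 < l0) (W0 : 0 <= W) (C0 : 0 <= C).
Hypotheses (b_gt0 : 0 < b) (b_le_n : b <= n%:R).
Hypothesis w_le : forall Q, w Q <= W.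
Hypothesis w_doubling : forall Q, 2 * side Q <= l0 ->
  exists2 Q', side Q' = 2 * side Q & w Q <= 2 ^- n * w Q' + C * side Q ^+ n.

(** Passing from side 2l to l multiplies A l^(n - b) by 2^(b - n), which is
    2^b > 1 times the factor 2^-n of the doubling inequality.  This margin absorbs
    the error C l^n once A is large, because l^b stays bounded. *)
Lemma doubling_morrey :
  exists2 A : R, 0 <= A & forall Q, w Q <= A * side Q `^ (n%:R - b).
Proof.
set p := n%:R - b; have p0 : 0 <= p by rewrite subr_ge0.
set t : R := (2 `^ b)^-1.
have tb : 1 < 2 `^ b :> R.
  by rewrite -[ltLHS](one_powR b); apply: lt_powR_base; rewrite // ltr1n.
have t1 : t < 1 by rewrite invf_lt1// (lt_trans _ tb).
(* A1 settles the cubes too large to be doubled, A2 absorbs the error term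
   of each halving. *)
pose A1 := W / (l0 / 2) `^ p; pose A2 := C * l0 `^ b / (1 - t).
have A10 : 0 <= A1 by rewrite divr_ge0// powR_ge0.
have A20 : 0 <= A2 by rewrite divr_ge0 ?mulr_ge0 ?powR_ge0// subr_ge0 ltW.
exists (A1 + A2) => [|Q]; first exact: addr_ge0.
(* k bounds the number of doublings after which the side exceeds l0 / 2. *)
have [k kQ] : exists k, l0 < 2 ^+ k * (2 * side Q).
  exists (Num.bound (l0 / (2 * side Q))).
  have s2 : 0 < 2 * side Q by rewrite mulr_gt0// side_gt0.
  by rewrite -ltr_pdivrMr//; exact: upper_nthrootP.
elim: k Q kQ => [|k IH] Q kQ; have sQ := side_gt0 Q.
  rewrite expr0 mul1r in kQ.
  have le_half : l0 / 2 <= side Q by rewrite ler_pdivrMr// mulrC ltW.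
  have half0 : 0 < (l0 / 2) `^ p by rewrite powR_gt0// divr_gt0.
  apply: (le_trans (w_le Q)); apply: (@le_trans _ _ (A1 * side Q `^ p)).
    rewrite -[leLHS](divfK (lt0r_neq0 half0) W) ler_wpM2l//.
    by apply: le_powR_base => //; rewrite divr_ge0// ltW.
  by rewrite ler_wpM2r ?powR_ge0// lerDl.
have [big|small] := ltP l0 (2 * side Q).
  by apply: IH; rewrite (lt_le_trans big)// ler_peMl ?mulr_ge0 ?(ltW sQ)// exprn_ege1// ler1n.
have [Q' sQ' wQ] := w_doubling small.
have /IH wQ' : l0 < 2 ^+ k * (2 * side Q') by rewrite sQ' mulrA -exprSr.
apply: (le_trans wQ).
have E1 : 2 ^- n * (side Q' `^ p) = t * side Q `^ p.
  rewrite sQ' powRM// ?ltW// mulrA; congr (_ * _).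
  have := powR_exp_sub n b (ltr0n R 2); rewrite -/p => <-.
  by rewrite /t invfM mulrAC mulVf ?mul1r// gt_eqF// powR_gt0.
have E2 : side Q ^+ n <= side Q `^ p * l0 `^ b.
  rewrite -(powR_exp_sub n b sQ) ler_wpM2l ?powR_ge0//.
  by apply: le_powR_base; rewrite ?ltW//; have := small; have := sQ; lra.
have E3 : C * l0 `^ b = A2 * (1 - t) by rewrite /A2 divfK// subr_eq0 gt_eqF.
have sp0 : 0 <= side Q `^ p := powR_ge0 _ _.
apply: (@le_trans _ _ ((A1 + A2) * (t * side Q `^ p) + C * (side Q `^ p * l0 `^ b))).
  apply: lerD; last by rewrite ler_wpM2l.
  by rewrite -E1 mulrCA ler_wpM2l// invr_ge0 exprn_ge0.
rewrite (mulrCA C) E3 -subr_ge0.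
rewrite [leRHS](_ : _ = A1 * ((1 - t) * side Q `^ p)); last by ring.
by apply: mulr_ge0 => //; apply: mulr_ge0 => //; rewrite subr_ge0 ltW.
Qed.

End Morrey.

(** * Comparing cubes around nearby points *)

Section MaximalModulus.
Context {R : realType} {n : nat}.
Variables (w : cube R n -> R) (W A b alpha : R).
Hypotheses (W0 : 0 <= W) (A0 : 0 <= A).
Hypotheses (b_lt_alpha : b < alpha) (alpha_lt_n : alpha < n%:R).
Hypothesis w_ge0 : forall Q, 0 <= w Q.
Hypothesis w_le : forall Q, w Q <= W.
Hypothesis w_mono : forall Q Q', cube_set Q `<=` cube_set Q' -> w Q <= w Q'.
Hypothesis w_morrey : forall Q, w Q <= A * side Q `^ (n%:R - b).

Let p := n%:R - alpha.
Let p_gt0 : 0 < p. Proof. by rewrite subr_gt0. Qed.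
Let V Q := side Q `^ (- p) * w Q.
Let V_ge0 Q : 0 <= V Q. Proof. by rewrite mulr_ge0// powR_ge0. Qed.

Lemma scaled_le_small Q : V Q <= A * side Q `^ (alpha - b).
Proof.
rewrite /V; have s0 := side_gt0 Q.
apply: le_trans (ler_wpM2l (powR_ge0 _ _) (w_morrey Q)) _.
rewrite mulrCA -powRD; last by rewrite (gt_eqF s0) implybT.
by rewrite (_ : - p + _ = alpha - b)// /p; ring.
Qed.

(** The Morrey bound is used for sides at most 1, the total mass [W] beyond. *)
Lemma scaled_le Q : V Q <= A + W.
Proof.
have s0 := side_gt0 Q; have [s1|s1] := leP (side Q) 1.
  apply: (le_trans (scaled_le_small Q)); rewrite -[leLHS]addr0 lerD//.
  rewrite ler_piMr// -(one_powR (alpha - b)).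
  by apply: le_powR_base; rewrite // ?subr_ge0 ltW.
rewrite -[leLHS]add0r lerD//; apply: le_trans (w_le Q); rewrite /V ler_piMl//.
rewrite powRN invf_le1 ?powR_gt0// -(one_powR p).
by apply: le_powR_base; rewrite // ltW.
Qed.

(** Small cubes have [V Q <= e] outright, by the Morrey bound.  Any other cube is
    thickened so as to contain [y], and [V] then drops at most by the factor
    (side Q / side Q')^p. *)
Lemma scaled_modulus (e : R) : 0 < e -> exists2 h : R, 0 < h &
  forall (x y : 'rV[R]_n) Q, (forall i, `|x ord0 i - y ord0 i| <= h) ->
    cube_set Q x -> exists2 Q', cube_set Q' y & V Q <= V Q' + e.
Proof.
move=> e0; have q0 : 0 < alpha - b by rewrite subr_gt0.
(* The side at which the Morrey bound A d^(alpha - b) falls below e. *)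
pose d : R := (e / (A + 1)) `^ (alpha - b)^-1.
have A1 : 0 < A + 1 by rewrite ltr_wpDl.
have d0 : 0 < d by rewrite powR_gt0// divr_gt0.
have small Q : side Q <= d -> V Q <= e.
  move=> sd; apply: (le_trans (scaled_le_small Q)).
  apply: (@le_trans _ _ (A * (e / (A + 1)))).
    have eA0 : 0 <= e / (A + 1) by rewrite divr_ge0// ltW.
    rewrite ler_wpM2l// -[leRHS](powR_rootK q0 eA0).
    by apply: le_powR_base => //; rewrite ltW// side_gt0.
  by rewrite mulrCA ger_pMr// ler_pdivrMr// mul1r lerDl.
pose B := A + W + 1.
have B0 : 0 < B by rewrite ltr_wpDl// addr_ge0.
(* The ratio of sides whose p-th power is 1 + e / B, so that thickening costs
   at most (e / B) V Q' <= e. *)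
pose r : R := (1 + e / B) `^ p^-1.
have eB : 0 < e / B by rewrite divr_gt0.
have r1 : 1 < r.
  by rewrite -(one_powR p^-1); apply: lt_powR_base; rewrite ?invr_gt0 ?ltrDl.
exists (d * (r - 1) / 2); first by rewrite !mulr_gt0// subr_gt0.
move=> x y Q xy xQ; set h := _ / 2 in xy.
have h0 : 0 <= h by rewrite ltW// !mulr_gt0// subr_gt0.
have [Q' [sQ' yQ' QQ']] := cube_thicken h0 xQ xy.
exists Q' => //; have sQ := side_gt0 Q.
have [sd|ds] := leP (side Q) d; first by rewrite (le_trans (small Q sd))// lerDr.
have ratio : side Q' <= r * side Q.
  rewrite sQ' /h mulrC divfK//.
  have : d * (r - 1) <= side Q * (r - 1).
    by apply: ler_wpM2r; rewrite ?subr_ge0 ltW.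
  lra.
have ratiop : side Q' `^ p <= (1 + e / B) * side Q `^ p.
  have eB1 : 0 <= 1 + e / B by rewrite addr_ge0// ltW.
  rewrite -[1 + e / B](powR_rootK p_gt0 eB1) -/r.
  rewrite -powRM ?(ltW sQ)//; last exact: le_trans (ltW r1).
  by apply: le_powR_base; rewrite ?(ltW p_gt0)// ltW// side_gt0.
have VQ' : V Q <= (1 + e / B) * V Q'.
  rewrite /V !powRN; have s0 : 0 < side Q `^ p by rewrite powR_gt0.
  have s0' : 0 < side Q' `^ p by rewrite powR_gt0// side_gt0.
  rewrite mulrA; apply: ler_pM; rewrite ?invr_ge0 ?w_mono ?(ltW s0)//.
  by rewrite ler_pdivlMr// mulrC ler_pdivrMr.
apply: (le_trans VQ'); rewrite mulrDl mul1r lerD2l.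
rewrite mulrAC ler_pdivrMr// ler_wpM2l ?(ltW e0)//.
by rewrite (le_trans (scaled_le Q'))// lerDl.
Qed.

End MaximalModulus.

(** * Bounded uniformly continuous functions have vanishing mean oscillation *)

Section UnifContinuousVMO.
Context {R : realType} {n : nat}.
Local Notation mu := (@lebesgue R n).
Local Notation T := (lebesgue_space R n).
Implicit Types (Q : cube R n) (g : 'rV[R]_n -> R).

Lemma ball_rowE (x y : 'rV[R]_n) (e : R) : 0 < e ->
  ball x e y <-> forall i, `|x ord0 i - y ord0 i| < e.
Proof.
move=> e0; split=> [[_ xy] i|xy]; first exact: (xy ord0 i).
by split=> // i j; rewrite !ord1; exact: xy.
Qed.

Lemma open_cube_set Q : open (cube_set Q).
Proof.
rewrite openE => x xQ; apply/nbhs_ballP.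
pose e := \big[Num.min/1]_(i < n)
  Num.min (x ord0 i - corner Q ord0 i) (corner Q ord0 i + side Q - x ord0 i).
have e0 : 0 < e.
  apply: lt_bigmin => [|i _]; first exact: ltr01.
  by rewrite lt_min !subr_gt0; exact: xQ.
exists e => //= y /(ball_rowE _ _ e0) xy i.
have : e <= Num.min (x ord0 i - corner Q ord0 i)
    (corner Q ord0 i + side Q - x ord0 i) by exact: bigmin_le.
by rewrite le_min => /andP[h1 h2]; have := xy i; rewrite ltr_norml; lra.
Qed.

(** The sigma-algebra is generated by the coordinates, so an open set is
    exhibited as a countable union: of the cubes with rational centre and
    half-side 1/(k+1) that it contains. *)
Lemma measurable_open_rV (U : set 'rV[R]_n) : open U -> measurable U.
Proof.
move=> oU.
have [rad [rad0 rad_lt]] : exists rad : nat -> R, (forall k, 0 < rad k) /\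
    forall e, 0 < e -> exists k, 2 * rad k < e.
  exists (fun k => k.+1%:R^-1); split=> [k|e e0]; first by rewrite invr_gt0.
  exists (Num.truncn (2 / e)); rewrite ltr_pdivrMr// mulrC -ltr_pdivrMr//.
  exact: truncnS_gt.
have r0 k : 0 < 2 * rad k by rewrite mulr_gt0.
pose Qq (qk : 'rV[rat]_n * nat) : cube R n :=
  Cube (\row_i (ratr (qk.1 ord0 i) - rad qk.2)) (r0 qk.2).
pose F qk := if `[< cube_set (Qq qk) `<=` U >] then cube_set (Qq qk) else set0.
rewrite (_ : U = \bigcup_qk F qk); last first.
  apply/seteqP; split=> [x Ux|x [qk _]]; last first.
    by rewrite /F; case: asboolP => // sub /sub.
  move: oU; rewrite openE => /(_ _ Ux) /nbhs_ballP[e /= e0 eU].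
  have [k ke] := rad_lt _ e0; have k0 := rad0 k.
  have q_ i : exists q : rat, x ord0 i - rad k < ratr q < x ord0 i + rad k.
    have [|q qx] := @rat_in_itvoo R (x ord0 i - rad k) (x ord0 i + rad k).
      by lra.
    by exists q; rewrite in_itv in qx.
  pose q := \row_i sval (cid (q_ i)).
  have xq y : cube_set (Qq (q, k)) y -> ball x e y.
    move=> yQ; apply/(ball_rowE _ _ e0) => i; have := yQ i; rewrite /= !mxE.
    by case: cid => r /= hr hy; rewrite ltr_norml; lra.
  exists (q, k) => //; rewrite /F asboolT => [i|y /xq/eU//].
  by rewrite /= !mxE; case: cid => r /= hr; lra.
apply: countable_bigcupT_measurable => // qk.
by rewrite /F; case: ifP => _; [exact: measurable_cube_set|exact: measurable0].
Qed.

Lemma continuous_Lmeasurable (D : set T) g : measurable D -> continuous g ->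
  measurable_fun D (g : T -> R).
Proof.
move=> mD cg; apply: (@measurability _ _ T (measurableTypeR R) D g _ (RGenOInfty.measurableE R)).
move=> _ [_ [a ->] <-]; apply: measurableI => //.
apply: Lmeasurable_Borel; apply: measurable_open_rV.
by apply: open_comp; [move=> x _; exact: cg|exact: interval_open].
Qed.

(** Boundedness gives the integrability and the finite seminorm, uniform
    continuity the decay: on a cube of side at most [d], [g] differs from its
    value at the centre by at most the modulus of continuity at [d]. *)
Lemma unif_continuous_bounded_VMO Q0 g (M : R) :
  unif_continuous g -> (forall x, `|g x| <= M) -> VMO Q0 g.
Proof.
move=> ug gM.
have ug' := (unif_continuousP g).1 ug.
have cg : continuous g.
  move=> x U /nbhs_ballP[e /= /ug'[d d0 gd] eU].
  by apply/nbhs_ballP; exists d => //= y xy; exact/eU/(gd (x, y)).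
have mg (D : set T) : measurable D -> measurable_fun D (g : T -> R).
  by move=> mD; exact: continuous_Lmeasurable.
have osc_le Q (c r : R) : (forall x, cube_set Q x -> `|g x - c| <= r) ->
    (oscillation g Q <= r%:E)%E.
  move=> gc; apply: (@le_trans _ _
    ((side Q ^- n)%:E * \int[mu]_(x in (cube_set Q : set T)) `|g x - c|%:E)%E).
    by apply: ereal_inf_lbound; exists c.
  have sn : 0 < side Q ^+ n by rewrite exprn_gt0// side_gt0.
  rewrite lee_pdivrMl// muleC -(lebesgue_cube Q).
  apply: (@integral_norm_le_bound _ _ _ mu _ (fun x => g x - c)) gc.
    exact: Lmeasurable_cube.
  by apply: measurable_funB; [apply: mg; exact: Lmeasurable_cube|].
have osc_ge0 Q : (0 <= oscillation g Q)%E.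
  apply: le_ereal_inf_tmp => _ [c _ <-]; rewrite mule_ge0 ?integral_ge0//.
  by rewrite lee_fin invr_ge0 exprn_ge0// ltW// side_gt0.
split.
  split; [split|].
  - by apply: mg; exact: Lmeasurable_cube.
  - exact: open_cube_set.
  - move=> K KQ0 cK.
    have mK : measurable (K : set T).
      apply: Lmeasurable_Borel; rewrite -[K]setCK; apply: measurableC.
      apply: measurable_open_rV; apply: closed_openC.
      by apply: compact_closed => //; exact: norm_hausdorff.
    have := integral_norm_le_bound mu mK (mg _ mK) (fun x _ => gM x).
    move=> /le_lt_trans; apply.
    have M0 : 0 <= M by exact: le_trans (normr_ge0 _) (gM 0).
    apply: (@le_lt_trans _ _ (M%:E * mu (cube_set Q0))%E).
      rewrite lee_wpmul2l// le_measure ?inE//; exact: Lmeasurable_cube.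
    by rewrite lebesgue_cube -EFinM ltry.
  - apply: (@le_lt_trans _ _ M%:E); last exact: ltry.
    apply: ge_ereal_sup => _ [Q _ <-]; apply: (osc_le Q 0) => x _.
    by rewrite subr0.
have sup_le e : 0 < e -> \forall r \near 0^'+,
    (0 <= ereal_sup [set oscillation g Q
       | Q in [set Q | subcubes Q0 Q /\ (side Q <= r)%R]] <= e%:E)%E.
  move=> e0; have [d d0 gd] := ug' _ e0.
  near=> r; have r0 : 0 < r by near: r; exact: nbhs_right_gt.
  have rd : r <= d by near: r; exact: nbhs_right_le.
  (* The supremum over no cube at all would be -oo; a small cube in the corner
     of Q0 makes it nonnegative. *)
  apply/andP; split.
    have m0 : 0 < Num.min r (side Q0) by rewrite lt_min r0 side_gt0.
    apply: le_ereal_sup_tmp; exists (oscillation g (Cube (corner Q0) m0)) => //.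
    exists (Cube (corner Q0) m0) => //=; split; last by rewrite ge_min lexx.
    move=> x /= xQ i; have /andP[-> /=] := xQ i.
    by move=> /lt_le_trans; apply; rewrite lerD2l ge_min lexx orbT.
  apply: ge_ereal_sup => _ [Q [_ Qr] <-].
  pose z : 'rV[R]_n := \row_i (corner Q ord0 i + side Q / 2).
  apply: (osc_le Q (g z)) => x xQ; apply/ltW; rewrite distrC.
  apply: (gd (z, x)); apply/(ball_rowE _ _ d0) => i /=.
  have := xQ i; rewrite mxE ltr_norml.
  have : side Q <= d by exact: le_trans rd.
  by have := side_gt0 Q; lra.
apply/fine_cvgP; split.
  apply: filterS (sup_le 1 ltr01) => r /andP[s0 s1].
  by rewrite ge0_fin_numE// (le_lt_trans s1)// ltry.
apply/cvgr0Pnorm_le => e e0; apply: filterS (sup_le e e0) => r /andP[s0 s1] /=.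
rewrite ger0_norm ?fine_ge0// -lee_fin fineK//.
by rewrite ge0_fin_numE// (le_lt_trans s1)// ltry.
Unshelve. all: by end_near.
Qed.
End UnifContinuousVMO.

(** * The fractional maximal function *)

Section FracMaximal.
Context {R : realType} {n : nat}.
Implicit Types (Q : cube R n) (x y : 'rV[R]_n).

Lemma cube_around x : exists Q : cube R n, cube_set Q x.
Proof.
exists (Cube (\row_i (x ord0 i - 1 / 2)) (@ltr01 R)) => i /=.
by rewrite mxE; lra.
Qed.

(** The hypothesis on [V] is one-sided, but [x] and [y] play symmetric roles in
    it, so it controls the difference of the two suprema in both directions. *)
Lemma sup_over_cubes_unif_continuous (V : cube R n -> R) (B : R) :
  (forall Q, 0 <= V Q <= B) ->
  (forall e, 0 < e -> exists2 h, 0 < h &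
    forall x y Q, (forall i, `|x ord0 i - y ord0 i| <= h) ->
      cube_set Q x -> exists2 Q', cube_set Q' y & V Q <= V Q' + e) ->
  let M x := ereal_sup [set (V Q)%:E | Q in [set Q | cube_set Q x]] in
  [/\ forall x, M x \is a fin_num,
      forall x, `|fine (M x)| <= B & unif_continuous (fun x => fine (M x))].
Proof.
move=> V0B Vmod M.
have M0 x : (0 <= M x)%E.
  have [Q xQ] := cube_around x; apply: le_ereal_sup_tmp; exists (V Q)%:E.
    by exists Q.
  by rewrite lee_fin; case/andP: (V0B Q).
have MB x : (M x <= B%:E)%E.
  by apply: ge_ereal_sup => _ [Q _ <-]; rewrite lee_fin; case/andP: (V0B Q).
have Mfin x : M x \is a fin_num.
  by rewrite ge0_fin_numE// (le_lt_trans (MB x))// ltry.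
split=> //.
  by move=> x; rewrite ger0_norm ?fine_ge0// -lee_fin fineK.
apply/unif_continuousP => e e0.
have [h h0 hV] := Vmod _ (divr_gt0 e0 (ltr0n R 2)).
have Mle x y : (forall i, `|x ord0 i - y ord0 i| <= h) ->
    fine (M x) <= fine (M y) + e / 2.
  move=> xy; rewrite -lee_fin EFinD !fineK//.
  apply: ge_ereal_sup => _ [Q xQ <-]; have [Q' yQ' VV] := hV _ _ _ xy xQ.
  rewrite (@le_trans _ _ (V Q' + e / 2)%:E) ?lee_fin// EFinD leeD2r//.
  by apply: ereal_sup_ubound; exists Q'.
exists h => // -[x y] /= /(ball_rowE _ _ h0) xy.
have xyh i : `|x ord0 i - y ord0 i| <= h by exact: ltW.
have yxh i : `|y ord0 i - x ord0 i| <= h by rewrite distrC.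
rewrite /ball /= ltr_norml; have := Mle _ _ xyh; have := Mle _ _ yxh; lra.
Qed.

End FracMaximal.

Theorem theorem1p4 (R : realType) (n : nat) (alpha : R) (Q0 : cube R n)
    (f : 'rV[R]_n -> R) :
  0 < alpha -> alpha < n%:R ->
  BMO Q0 f ->
  [set x | f x != 0] `<=` cube_set Q0 ->
  [/\ forall x, frac_maximal alpha f x \is a fin_num,
      unif_continuous (fun x => fine (frac_maximal alpha f x)) &
      VMO Q0 (fun x => fine (frac_maximal alpha f x))].
Proof.
move=> a0 an [[mf _ _] bmo] f0.
pose mass (Q : cube R n) : \bar R :=
  (\int[@lebesgue R n]_(y in cube_set Q) `|f y|%:E)%E.
pose w Q := fine (mass Q).
have mass_ge0 Q : (0 <= mass Q)%E by exact: integral_ge0.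
have mQ := @Lmeasurable_cube R n.
have mass_le Q Q' : cube_set Q `&` cube_set Q0 `<=` cube_set Q' ->
    (mass Q <= mass Q')%E.
  exact: (integral_norm_le_support _ (mQ Q0) mf f0).
have massQ0 Q : (mass Q <= mass Q0)%E by apply: mass_le => x [].
have mass_fin Q : mass Q \is a fin_num.
  by rewrite ge0_fin_numE// (le_lt_trans (massQ0 Q))// (BMO_integrable mf bmo).
have massE Q : mass Q = (w Q)%:E by rewrite fineK.
have w_ge0 Q : 0 <= w Q by rewrite fine_ge0.
have w_le Q : w Q <= w Q0 by rewrite -lee_fin -!massE.
have w_mono Q Q' : cube_set Q `<=` cube_set Q' -> w Q <= w Q'.
  by move=> QQ'; rewrite -lee_fin -!massE; apply: mass_le => x [/QQ'].
have [C C0 mass_dbl] := mass_doubling mf f0 bmo.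
have w_dbl Q : 2 * side Q <= side Q0 -> exists2 Q', side Q' = 2 * side Q &
    w Q <= 2 ^- n * w Q' + C * side Q ^+ n.
  move=> /mass_dbl[Q' sQ' le]; exists Q' => //.
  by rewrite -lee_fin EFinD EFinM -!massE.
(* Any Morrey exponent strictly between 0 and alpha would do. *)
pose b := alpha / 2.
have b0 : 0 < b by rewrite divr_gt0.
have ba : b < alpha by rewrite /b; lra.
have bn : b <= n%:R by rewrite ltW// (lt_trans ba).
have [A A0 w_morrey] := doubling_morrey
  (side_gt0 Q0) (w_ge0 Q0) C0 b0 bn w_le w_dbl.
pose V Q := side Q `^ (- (n%:R - alpha)) * w Q.
have ME : frac_maximal alpha f =
    fun x => ereal_sup [set (V Q)%:E | Q in [set Q | cube_set Q x]].
  apply/funext => x; congr ereal_sup; apply: eq_imagel => Q _.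
  by rewrite -[X in (_ * X)%E]/(mass Q) massE -EFinM.
have V0B Q : 0 <= V Q <= A + w Q0.
  rewrite mulr_ge0 ?powR_ge0//=.
  exact: (scaled_le (w_ge0 Q0) A0 ba an w_ge0 w_le w_morrey).
have Vmod := scaled_modulus (w_ge0 Q0) A0 ba an w_ge0 w_le w_mono w_morrey.
have [Mfin MB Mcont] := sup_over_cubes_unif_continuous V0B Vmod.
rewrite ME; split; [exact: Mfin|exact: Mcont|].
exact: unif_continuous_bounded_VMO Mcont MB.
Qed.
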